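(* Let $H$ be an infinite dimensional separable complex Hilbert space and let $V=B(H)_{sa}$ as a JB-algebra. Then $\mathrm{str}(V)=\{\ell_T+r_{T^\dagger}: T\in B(H)\}$, where each $\ell_T+r_{T^\dagger}$ is regarded as the operator $A\mapsto TA+AT^\dagger$ on $V$.
   Context: $V=B(H)_{sa}$ is the real Banach space of bounded self-adjoint operators on $H$ with operator norm and Jordan product $A\circ B=\frac12(AB+BA)$. $B(V)$ is the algebra of bounded real-linear operators on $V$. $\ell_T(X)=TX$, $r_T(X)=XT$; $\dagger$ is the Hilbert space adjoint. Here $U_X(A)=XAX$ and $U_{X,Y}(A)=\frac12(XAY+YAX)$, and $\mathrm{str}(V)$, the Lie algebra of the structure group of $V$, is the set of $D\in B(V)$ for which there exists $\overline D\in B(V)$ with $2U_{X,D(X)}=DU_X-U_X\overline D$ for all $X\in V$, i.e. $XA\,D(X)+D(X)AX=D(XAX)-X\overline D(A)X$ for all $A,X\in V$. *)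

(* Defs.v *)
From HB Require Import structures.
From mathcomp Require Import all_boot all_order all_algebra.
From mathcomp Require Import sesquilinear interval_inference complex ring lra.
From mathcomp Require Import all_classical all_reals topology normedtype sequences.

Set Implicit Arguments.
Unset Strict Implicit.
Unset Printing Implicit Defensive.

Import Order.TTheory GRing.Theory Num.Theory.
Import numFieldNormedType.Exports.

Local Open Scope classical_set_scope.
Local Open Scope complex_scope.
Local Open Scope ring_scope.

(* Instantiated with K = R[i] to get B(H), and with K = R to get B(V) for
   V = B(H)_sa; the product of the ring structure is composition. *)
Section BoundedOperators.
Variables (K : numFieldType) (U : normedModType K).
Implicit Types f g : U -> U.

Definition bounded_linear : set (U -> U) :=
  [set f | linear f /\ exists M : K, forall x, `|f x| <= M * `|x|].

Record bop := Bop { bop_fun :> U -> U; _ : bop_fun \in bounded_linear }.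

HB.instance Definition _ := [isSub for bop_fun].
HB.instance Definition _ := [Choice of bop by <:].

Lemma bounded_linear_gt0 f : bounded_linear f ->
  exists2 M : K, 0 < M & forall x, `|f x| <= M * `|x|.
Proof.
move=> [fl [M fM]].
have [[x x0]|x0] := pselect (exists x : U, x != 0); last first.
  have {}x0 (x : U) : x = 0 by apply: contrapT => /eqP xn0; apply: x0; exists x.
  by exists 1 => // x; rewrite (x0 x) (x0 (f 0)) normr0 mulr0.
have M0 : 0 <= M.
  have := le_trans (normr_ge0 _) (fM x).
  by rewrite pmulr_lge0 // normr_gt0.
exists (M + 1); first by rewrite ltr_wpDl.
by move=> y; rewrite (le_trans (fM y)) // ler_wpM2r // lerDl.
Qed.

Lemma bounded_linear_submod : subsemimod_closed (mem bounded_linear).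
Proof.
split; [split|].
- rewrite inE; split.
    by move=> a x y /=; rewrite scaler0 addr0.
  by exists 0 => x; rewrite normr0 mul0r.
- move=> f g; rewrite !inE => fL gL; split.
    move=> a x y /=; rewrite (_ : (f + g) _ = f (a *: x + y) + g (a *: x + y)) //.
    case: fL gL => fl _ [gl _]; rewrite fl gl scalerDr addrACA //.
  have [M M0 fM] := bounded_linear_gt0 fL; have [N N0 gN] := bounded_linear_gt0 gL.
  exists (M + N) => x; rewrite (le_trans (ler_normD _ _)) //.
  by rewrite mulrDl lerD.
- move=> a f; rewrite !inE => -[fl [M fM]]; split.
    move=> b x y /=; rewrite (_ : (a *: f) _ = a *: f (b *: x + y)) //.
    by rewrite fl scalerDr !scalerA mulrC.
  exists (`|a| * M) => x; rewrite (_ : (a *: f) x = a *: f x) //.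
  by rewrite normrZ -mulrA ler_wpM2l.
Qed.

HB.instance Definition _ :=
  GRing.SubChoice_isSubLmodule.Build K (U -> U) (mem bounded_linear) bop
    bounded_linear_submod.

Lemma bopP (T S : bop) : T =1 S -> T = S.
Proof. by move=> TS; apply/val_inj/funext. Qed.

Lemma bop_bl (T : bop) : bounded_linear T.
Proof. by case: T => f /= /set_mem. Qed.

Lemma bop_linear (T : bop) : linear T.
Proof. by case: (bop_bl T). Qed.

Lemma bop0 (T : bop) : T 0 = 0.
Proof. by have := bop_linear T (-1) 0 0; rewrite !scaleN1r !addNr. Qed.

Lemma bopD (T : bop) x y : T (x + y) = T x + T y.
Proof. by have := bop_linear T 1 x y; rewrite !scale1r. Qed.

Lemma bopZ (T : bop) a x : T (a *: x) = a *: T x.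
Proof. by have := bop_linear T a x 0; rewrite !addr0 bop0 addr0. Qed.

Lemma comp_bounded_linear (T S : bop) : T \o S \in bounded_linear.
Proof.
rewrite inE; split.
  by move=> a x y; rewrite /= (bop_linear S) (bop_linear T).
have [M M0 fM] := bounded_linear_gt0 (bop_bl T).
have [N N0 gN] := bounded_linear_gt0 (bop_bl S).
exists (M * N) => x; rewrite (le_trans (fM _)) // -mulrA.
by rewrite ler_wpM2l // ltW.
Qed.

Lemma id_bounded_linear : id \in bounded_linear.
Proof. by rewrite inE; split => //; exists 1 => x; rewrite mul1r. Qed.

Definition bop_comp (T S : bop) : bop := Bop (comp_bounded_linear T S).
Definition bop_id : bop := Bop id_bounded_linear.

Lemma bop_addE (T S : bop) x : (T + S) x = T x + S x. Proof. by []. Qed.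
Lemma bop_oppE (T : bop) x : (- T) x = - T x. Proof. by []. Qed.
Lemma bop_scaleE (a : K) (T : bop) x : (a *: T) x = a *: T x. Proof. by []. Qed.

Lemma bop_compA : associative bop_comp. Proof. by move=> *; exact: bopP. Qed.
Lemma bop_comp1l : left_id bop_id bop_comp. Proof. by move=> *; exact: bopP. Qed.
Lemma bop_comp1r : right_id bop_id bop_comp. Proof. by move=> *; exact: bopP. Qed.
Lemma bop_compDl : left_distributive bop_comp +%R.
Proof. by move=> *; exact: bopP. Qed.
Lemma bop_compDr : right_distributive bop_comp +%R.
Proof. by move=> T S S'; apply: bopP => x; rewrite /= bopD. Qed.

HB.instance Definition _ := GRing.Zmodule_isPzRing.Build bop
  bop_compA bop_comp1l bop_comp1r bop_compDl bop_compDr.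

Lemma bop_mulE (T S : bop) x : (T * S) x = T (S x). Proof. by []. Qed.

End BoundedOperators.

Notation "''B' ( U )" := (@bop _ U) (format "''B' ( U )") : type_scope.

(* The inner product is linear in its first argument and conjugate-linear in the
   second one; its positivity is part of the library structure {dot _ for _}. *)
Record hilbertType (R : realType) := HilbertType {
  hilbert_sort :> completeNormedModType R[i];
  hdot : {dot hilbert_sort for Num.conj};
  hnormE : forall x, `|x| ^+ 2 = hdot x x }.

Definition infinite_dimensional (R : realType) (H : hilbertType R) :=
  ~ exists (n : nat) (b : 'I_n -> H),
      forall x : H, exists c : 'I_n -> R[i], x = \sum_(i < n) c i *: b i.

Definition separable (T : topologicalType) :=
  exists2 D : set T, countable D & dense D.

Section HilbertTheory.
Variables (R : realType) (H : hilbertType R).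
Implicit Types (x y z : H) (T S : 'B(H)).

Local Notation dot := (@hdot R H).

Lemma dotDl x y z : dot (x + y) z = dot x z + dot y z.
Proof. by rewrite linearDl. Qed.
Lemma dotDr x y z : dot z (x + y) = dot z x + dot z y.
Proof. by rewrite linearDr. Qed.
Lemma dotBl x y z : dot (x - y) z = dot x z - dot y z.
Proof. by rewrite linearBl. Qed.
Lemma dotBr x y z : dot z (x - y) = dot z x - dot z y.
Proof. by rewrite linearBr. Qed.
Lemma dotZl a x z : dot (a *: x) z = a * dot x z.
Proof. by rewrite linearZl_LR. Qed.
Lemma dotZr a x z : dot z (a *: x) = a^* * dot z x.
Proof. by rewrite linearZr_LR. Qed.
Lemma dotC x y : dot x y = (dot y x)^*.
Proof. by rewrite hermC /= expr0 mul1r. Qed.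

Lemma dot_ext x y : (forall z, dot z x = dot z y) -> x = y.
Proof.
move=> xy; apply/eqP; rewrite -subr_eq0 -(dnorm_eq0 dot) dotBr; apply/eqP.
by rewrite xy subrr.
Qed.

Definition nrm x : R := complex.Re `|x|.

Lemma ge0_ReC (a : R[i]) : 0 <= a -> a = (complex.Re a)%:C.
Proof. by case: a => r i; rewrite lecE /= => /andP[/eqP-> _]. Qed.

Lemma nrmE x : `|x| = (nrm x)%:C.
Proof. exact: ge0_ReC. Qed.

Lemma nrm_ge0 x : 0 <= nrm x.
Proof. by rewrite -lecR -nrmE; exact: normr_ge0. Qed.

Lemma nrmD x y : nrm (x + y) <= nrm x + nrm y.
Proof. by rewrite -lecR rmorphD /= -!nrmE ler_normD. Qed.

Lemma nrmZ (a : R[i]) x : nrm (a *: x) = complex.Re `|a| * nrm x.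
Proof.
have E : `|a *: x| = (complex.Re `|a| * nrm x)%:C.
  by rewrite rmorphM /= -(nrmE x) -(ge0_ReC (normr_ge0 a)) normrZ.
by apply: (@complexI R); rewrite -nrmE.
Qed.

Lemma nrm0 : nrm 0 = 0. Proof. by rewrite /nrm normr0. Qed.

Lemma nrm_eq0 x : nrm x = 0 -> x = 0.
Proof. by move=> x0; apply/normr0_eq0; rewrite nrmE x0. Qed.

Lemma nrm2 x : dot x x = (nrm x ^+ 2)%:C.
Proof. by rewrite -hnormE nrmE rmorphXn. Qed.

Lemma parallelogram x y :
  nrm (x + y) ^+ 2 + nrm (x - y) ^+ 2 = nrm x ^+ 2 *+ 2 + nrm y ^+ 2 *+ 2.
Proof.
apply: (@complexI R); rewrite !(rmorphD, rmorphMn) /= -!nrm2.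
by rewrite !(dotBl, dotBr, dotDl, dotDr); ring.
Qed.

Lemma cauchy_schwarz x y : `|dot x y| <= `|x| * `|y|.
Proof.
have [->|y0] := eqVneq y 0.
  by rewrite (_ : dot x 0 = 0) ?normr0 ?mulr0 // linear0r.
have yy0 : dot y y != 0 by rewrite dnorm_eq0.
rewrite -ler_sqr ?nnegrE ?mulr_ge0 // exprMn !hnormE.
pose z := x - (dot x y / dot y y) *: y.
have : 0 <= dot z z * dot y y by rewrite mulr_ge0 ?dnorm_ge0.
have zy : dot z y = 0 by rewrite dotBl dotZl divfK // subrr.
rewrite {2}/z dotBr dotZr zy mulr0 subr0 /z dotBl dotZl (dotC y x).
by rewrite mulrBl mulrAC divfK // -normCK subr_ge0.
Qed.

Lemma nrmN x : nrm (- x) = nrm x.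
Proof. by rewrite /nrm normrN. Qed.

Lemma nrm_cauchy_cvg (u : nat -> H) :
  (forall e : R, 0 < e ->
     exists N, forall m n, (N <= m)%N -> (N <= n)%N -> nrm (u m - u n) <= e) ->
  exists l, forall e : R, 0 < e ->
     exists N, forall n, (N <= n)%N -> nrm (l - u n) <= e.
Proof.
move=> uC.
have : cauchy (u @ \oo).
  apply/cauchyP => e e0.
  have eE : e = (complex.Re e)%:C by apply: ge0_ReC; exact: ltW.
  have e0' : 0 < complex.Re e by rewrite -ltcR -eE.
  have /uC[N uN] : 0 < complex.Re e / 2 by rewrite divr_gt0.
  exists (u N), N => // n /= Nn; rewrite -ball_normE /= eE nrmE ltcR.
  apply: (le_lt_trans (uN _ _ (leqnn N) Nn)).
  by rewrite ltr_pdivrMr // ltr_pMr // ltr1n.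
move=> /cauchy_cvgP/cvg_ex[l ul]; exists l => e e0.
have e0' : 0 < e%:C by rewrite ltcR.
move/cvgrPdist_le : ul => /(_ _ e0')[N _ uN].
by exists N => n Nn; rewrite -lecR -nrmE; exact: uN.
Qed.

Lemma riesz (f : H -> R[i]) :
  (forall a x y, f (a *: x + y) = a * f x + f y) ->
  (exists M : R[i], forall x, `|f x| <= M * `|x|) ->
  exists y, forall x, f x = dot x y.
Proof.
move=> fl [M fM].
have f0 : f 0 = 0 by have := fl (-1) 0 0; rewrite scaleN1r addNr mulN1r addNr.
have fD x y : f (x + y) = f x + f y by have := fl 1 x y; rewrite scale1r mul1r.
have fZ a x : f (a *: x) = a * f x by have := fl a x 0; rewrite !addr0 f0 addr0.
have fN x : f (- x) = - f x by rewrite -scaleN1r fZ mulN1r.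
have [[x1 fx1]|fx0] := pselect (exists x, f x != 0); last first.
  exists 0 => x; rewrite linear0r; apply: contrapT => /eqP fx; apply: fx0.
  by exists x.
have {x1 fx1} [x1 fx1] : exists x, f x = 1.
  by exists ((f x1)^-1 *: x1); rewrite fZ mulVf.
pose S := [set nrm x ^+ 2 | x in [set x | f x = 1]].
have S_inf : has_inf S.
  split; first by exists (nrm x1 ^+ 2), x1.
  by exists 0 => _ [x _ <-]; exact: sqr_ge0.
pose d := inf S.
have dle x : f x = 1 -> d <= nrm x ^+ 2.
  by move=> fx; apply: ge_inf; [case: S_inf|exists x].
have /choice[u uP] n : exists x, f x = 1 /\ nrm x ^+ 2 <= d + n.+1%:R^-1.
  have n0 : 0 < (n.+1%:R^-1 : R) by rewrite invr_gt0 ltr0n.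
  have [_ [x fx <-] xd] := inf_adherent n0 S_inf.
  by exists x; split => //; exact: ltW.
have u_near m n : nrm (u m - u n) ^+ 2 <= (m.+1%:R^-1 + n.+1%:R^-1) *+ 2.
  have [fm um] := uP m; have [fn un] := uP n.
  have := parallelogram (u m) (u n).
  have : f (2^-1 *: (u m + u n)) = 1 by rewrite fZ fD fm fn -mulr2n mulVf // pnatr_eq0.
  move/dle; rewrite nrmZ exprMn.
  have -> : complex.Re `|2^-1 : R[i]| = 2^-1.
    have -> : (2^-1 : R[i]) = (2^-1)%:C by rewrite fmorphV rmorph_nat.
    by rewrite ger0_norm // lecR invr_ge0.
  have -> : (2^-1 : R) ^+ 2 = 4^-1 by rewrite exprVn -natrX.
  move: um un; move: (nrm (u m) ^+ 2) (nrm (u n) ^+ 2) (nrm (u m - u n) ^+ 2).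
  move: (nrm (u m + u n) ^+ 2) (m.+1%:R^-1 : R) (n.+1%:R^-1 : R).
  clearbody d; by move=> *; lra.
have arch (e : R) : 0 < e -> exists N, forall n, (N <= n)%N -> n.+1%:R^-1 <= e.
  move=> /posnumP[{}e]; have [N _ Ne] := near_infty_natSinv_lt e.
  by exists N => n Nn; exact/ltW/Ne.
have [z zP] : exists l, forall e : R, 0 < e ->
     exists N, forall n, (N <= n)%N -> nrm (l - u n) <= e.
  apply: nrm_cauchy_cvg => e e0.
  have /arch[N NP] : 0 < e ^+ 2 / 4 by rewrite divr_gt0 // exprn_gt0.
  exists N => m n Nm Nn; rewrite -ler_sqr ?nnegrE ?nrm_ge0 ?(ltW e0) //.
  rewrite (le_trans (u_near m n)) //.
  move: (NP _ Nm) (NP _ Nn); move: (e ^+ 2) (m.+1%:R^-1 : R) (n.+1%:R^-1 : R).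
  by move=> *; lra.
have fz : f z = 1.
  have [M' M'0 fM'] : exists2 M' : R, 0 < M' & forall x, `|f x| <= (M' * nrm x)%:C.
    have M0 : 0 <= M.
      have := le_trans (normr_ge0 _) (fM x1); rewrite pmulr_lge0 // normr_gt0.
      by apply/eqP => x10; move: fx1; rewrite x10 f0 => /eqP; rewrite eq_sym oner_eq0.
    exists (complex.Re M + 1).
      by rewrite ltr_wpDl // -lecR -(ge0_ReC M0).
    move=> x; rewrite (le_trans (fM x)) // rmorphM /= -nrmE ler_wpM2r //.
    by rewrite rmorphD /= -(ge0_ReC M0) lerDl ler01.
  have fz1 : `|f z - 1| = (complex.Re `|f z - 1|)%:C by exact: ge0_ReC.
  apply/eqP; rewrite -subr_eq0 -normr_eq0 fz1; apply/eqP; congr (_ %:C).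
  apply/eqP; rewrite eq_le; apply/andP; split; last first.
    by rewrite -lecR -fz1; exact: normr_ge0.
  apply/ler_addgt0Pr => e e0; rewrite add0r.
  have /zP[N /(_ N (leqnn N)) zN] : 0 < e / M' by rewrite divr_gt0.
  rewrite -lecR -fz1 -(uP N).1 -fN -fD (le_trans (fM' _)) // lecR.
  by rewrite mulrC -ler_pdivlMr.
have zd : nrm z ^+ 2 <= d.
  have d0 : 0 <= d.
    apply: lb_le_inf; first by case: S_inf.
    by move=> _ [x _ <-]; exact: sqr_ge0.
  rewrite -[d]sqr_sqrtr // ler_sqr ?nnegrE ?nrm_ge0 ?sqrtr_ge0 //.
  apply/ler_addgt0Pr => e e0.
  have e20 : 0 < e / 2 by rewrite divr_gt0.
  have [N1 N1P] := zP _ e20.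
  have /arch[N2 N2P] : 0 < (e / 2) ^+ 2 by rewrite exprn_gt0.
  pose n := maxn N1 N2.
  have zun := N1P n (leq_maxl _ _).
  have nd := N2P n (leq_maxr _ _).
  have un : nrm (u n) <= Num.sqrt d + e / 2.
    rewrite -ler_sqr ?nnegrE ?nrm_ge0 ?addr_ge0 ?sqrtr_ge0 ?(ltW e20) //.
    rewrite (le_trans (uP n).2) // sqrrD sqr_sqrtr //.
    rewrite (le_trans (_ : _ <= d + (e / 2) ^+ 2)) ?lerD2l //.
    by rewrite lerD2r lerDl mulrn_wge0 // mulr_ge0 ?sqrtr_ge0 // ltW.
  rewrite -[z](subrK (u n)) (le_trans (nrmD _ _)) //.
  by lra.
have z0 : z != 0 by apply/eqP => z0; move: fz; rewrite z0 f0 => /eqP; rewrite eq_sym oner_eq0.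
have zz0 : dot z z != 0 by rewrite dnorm_eq0.
have orth w : f w = 0 -> dot w z = 0.
  move=> fw; have [->|w0] := eqVneq w 0; first by rewrite linear0l.
  have ww : 0 < dot w w by rewrite dnorm_gt0.
  pose t := - (dot z w / dot w w).
  have : dot z z <= dot (z + t *: w) (z + t *: w).
    rewrite !nrm2 lecR (le_trans zd) // dle //.
    by rewrite fD fZ fw mulr0 addr0.
  rewrite -subr_ge0 !(dotDl, dotDr) !(dotZl, dotZr) (dotC w z).
  set a := dot z w; set b := dot w w in t ww *.
  have bc : b^* = b by apply: geC0_conj; exact: ltW.
  have tE : t^* = - (a^* / b) by rewrite rmorphN rmorphM /= fmorphV /= bc.
  have -> : dot z z + t^* * a + (t * a^* + t * (t^* * b)) - dot z z = - (`|a| ^+ 2 / b).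
    rewrite tE /t normCK; field; exact: lt0r_neq0.
  rewrite oppr_ge0 pmulr_lle0 ?invr_gt0 // => a0.
  have : `|a| ^+ 2 == 0 by rewrite eq_le a0 exprn_ge0.
  by rewrite sqrf_eq0 normr_eq0 => /eqP ->; rewrite rmorph0.
exists ((dot z z)^-1 *: z) => x.
have : dot (x - f x *: z) z = 0 by apply: orth; rewrite fD fN fZ fz mulr1 subrr.
rewrite dotBl dotZl => /subr0_eq xz.
by rewrite dotZr xz fmorphV /= -dotC mulrC mulfK.
Qed.

Lemma adjoint_exists T : exists S, forall x y, dot (T x) y = dot x (S y).
Proof.
have [M M0 TM] := bounded_linear_gt0 (bop_bl T).
have /choice[S TS] y : exists z, forall x, dot (T x) y = dot x z.
  apply: riesz => [a u v|]; first by rewrite bop_linear dotDl dotZl.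
  exists (M * `|y|) => x; rewrite (le_trans (cauchy_schwarz _ _)) //.
  by rewrite mulrAC ler_wpM2r.
have Sbl : S \in @bounded_linear _ H.
  rewrite inE; split.
    move=> a u v; apply: dot_ext => x.
    by rewrite -TS dotDr dotZr !TS -dotZr -dotDr.
  exists M => y; have [->|Sy0] := eqVneq (S y) 0.
    by rewrite normr0 mulr_ge0 // ltW.
  rewrite -(@ler_pM2l _ `|S y|) ?normr_gt0 // -expr2 hnormE -TS.
  have -> : dot (T (S y)) y = `|dot (T (S y)) y| by rewrite TS ger0_norm ?dnorm_ge0.
  rewrite (le_trans (cauchy_schwarz _ _)) // mulrA ler_wpM2r //.
  by rewrite mulrC TM.
by exists (Bop Sbl).
Qed.

(* Unique by adjoint_uniq; it exists by the Riesz representation theorem. *)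
Definition adjoint T : 'B(H) := sval (cid (adjoint_exists T)).

Lemma adjointP T x y : dot (T x) y = dot x (adjoint T y).
Proof. by rewrite /adjoint; case: cid. Qed.

Lemma adjoint_uniq T S : (forall x y, dot (T x) y = dot x (S y)) -> adjoint T = S.
Proof. by move=> TS; apply: bopP => y; apply: dot_ext => x; rewrite -adjointP. Qed.

Lemma adjointK : involutive (@adjoint).
Proof. by move=> T; apply: adjoint_uniq => x y; rewrite dotC -adjointP -dotC. Qed.

Lemma adjointD T S : adjoint (T + S) = adjoint T + adjoint S.
Proof. by apply: adjoint_uniq => x y; rewrite dotDl dotDr !adjointP. Qed.

Lemma adjointZ (a : R[i]) T : adjoint (a *: T) = a^* *: adjoint T.
Proof. by apply: adjoint_uniq => x y; rewrite dotZl dotZr conjCK adjointP. Qed.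

Lemma adjointN T : adjoint (- T) = - adjoint T.
Proof. by rewrite -scaleN1r adjointZ rmorphN1 scaleN1r. Qed.

Lemma adjoint0 : adjoint 0 = 0.
Proof. by rewrite -(scale0r 0) adjointZ conjC0 !scale0r. Qed.

Lemma adjointM T S : adjoint (T * S) = adjoint S * adjoint T.
Proof. by apply: adjoint_uniq => x y; rewrite !bop_mulE !adjointP. Qed.

Definition opnorm T : R := sup [set nrm (T x) | x in [set x | nrm x <= 1]].

Lemma opnorm_has_sup T : has_sup [set nrm (T x) | x in [set x | nrm x <= 1]].
Proof.
split; first by exists (nrm (T 0)), 0 => //=; rewrite nrm0.
have [M M0 TM] := bounded_linear_gt0 (bop_bl T).
exists (complex.Re M) => _ [x /= x1 <-].
rewrite -lecR -nrmE (le_trans (TM x)) // -(ge0_ReC (ltW M0)).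
by rewrite nrmE ler_piMr ?(ltW M0) // lecR.
Qed.

Lemma opnorm_ge0 T : 0 <= opnorm T.
Proof.
rewrite (le_trans (nrm_ge0 (T 0))) //; apply: ub_le_sup.
  by case: (opnorm_has_sup T).
by exists 0 => //=; rewrite nrm0.
Qed.

Lemma opnorm_ub T x : nrm (T x) <= opnorm T * nrm x.
Proof.
have [->|x0] := eqVneq x 0; first by rewrite bop0 nrm0 mulr0.
have nx0 : 0 < nrm x.
  by rewrite lt_neqAle nrm_ge0 andbT eq_sym; apply: contra x0 => /eqP/nrm_eq0->.
rewrite -ler_pdivrMr //.
have nV : complex.Re `|((nrm x)^-1)%:C| = (nrm x)^-1.
  by rewrite ger0_norm // lecR invr_ge0 ltW.
rewrite mulrC -{1}nV -nrmZ -bopZ; apply: ub_le_sup.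
  by case: (opnorm_has_sup T).
by exists (((nrm x)^-1)%:C *: x) => //=; rewrite nrmZ nV mulVf // gt_eqF.
Qed.

Lemma opnorm_le T (M : R) : (forall x, nrm (T x) <= M * nrm x) -> 0 <= M ->
  opnorm T <= M.
Proof.
move=> TM M0; apply: ge_sup; first by case: (opnorm_has_sup T).
by move=> _ [x /= x1 <-]; rewrite (le_trans (TM x)) // ler_piMr.
Qed.

Lemma opnormD T S : opnorm (T + S) <= opnorm T + opnorm S.
Proof.
apply: opnorm_le => [x|]; last by rewrite addr_ge0 // opnorm_ge0.
by rewrite (le_trans (nrmD _ _)) // mulrDl lerD // opnorm_ub.
Qed.

Lemma opnormM T S : opnorm (T * S) <= opnorm T * opnorm S.
Proof.
apply: opnorm_le => [x|]; last by rewrite mulr_ge0 // opnorm_ge0.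
rewrite bop_mulE (le_trans (opnorm_ub T (S x))) // -mulrA ler_wpM2l ?opnorm_ge0 //.
exact: opnorm_ub.
Qed.

Lemma opnorm_eq0 T : opnorm T = 0 -> T = 0.
Proof.
move=> T0; apply: bopP => x; apply: nrm_eq0; apply/eqP.
rewrite eq_le nrm_ge0 andbT.
by have := opnorm_ub T x; rewrite T0 mul0r.
Qed.

Lemma opnormZ_le (a : R[i]) T : opnorm (a *: T) <= complex.Re `|a| * opnorm T.
Proof.
have a0 : 0 <= complex.Re `|a| by rewrite -lecR -(ge0_ReC (normr_ge0 a)); exact: normr_ge0.
apply: opnorm_le => [x|]; last by rewrite mulr_ge0 ?opnorm_ge0.
by rewrite bop_scaleE nrmZ -mulrA ler_wpM2l // opnorm_ub.
Qed.

Lemma opnormZ (a : R) T : opnorm (a%:C *: T) = `|a| * opnorm T.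
Proof.
have nC (b : R) : complex.Re `|b%:C| = `|b| by rewrite normc_def /= expr0n addr0 sqrtr_sqr.
apply/eqP; rewrite eq_le -{1}nC opnormZ_le /=.
have [->|a0] := eqVneq a 0; first by rewrite normr0 mul0r opnorm_ge0.
rewrite mulrC -ler_pdivlMr ?normr_gt0 // mulrC -normfV -(nC a^-1).
rewrite (le_trans _ (opnormZ_le _ _)) // scalerA -rmorphM mulVf //.
by rewrite rmorph1 scale1r.
Qed.

(* V = B(H)_sa: a *real* vector space (a : R acts as a%:C), with the operator
   norm inherited from B(H). *)
Record bsa := Bsa { bsa_op :> 'B(H); _ : adjoint bsa_op == bsa_op }.

HB.instance Definition _ := [isSub for bsa_op].
HB.instance Definition _ := [Choice of bsa by <:].

Implicit Types A X Y : bsa.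

Lemma bsaP A X : bsa_op A = bsa_op X -> A = X.
Proof. exact: val_inj. Qed.

Lemma bsa_adj A : adjoint A = A.
Proof. by case: A => A /= /eqP. Qed.

Lemma bsa_zmod_closed : zmod_closed [pred T : 'B(H) | adjoint T == T].
Proof.
split; first by apply/eqP; exact: adjoint0.
move=> T S /(@eqP 'B(H)) T1 /(@eqP 'B(H)) S1; apply/(@eqP 'B(H)).
by rewrite adjointD adjointN T1 S1.
Qed.

HB.instance Definition _ := GRing.SubChoice_isSubZmodule.Build 'B(H)
  [pred T : 'B(H) | adjoint T == T] bsa bsa_zmod_closed.

Lemma bsa_scale_sa (a : R) A : adjoint (a%:C *: bsa_op A) == a%:C *: bsa_op A.
Proof. by rewrite adjointZ bsa_adj (conjc_real a : (a%:C)^* = a%:C). Qed.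

Definition bsa_scale (a : R) A : bsa := Bsa (bsa_scale_sa a A).

Fact bsa_scalerA (a b : R) A : bsa_scale a (bsa_scale b A) = bsa_scale (a * b) A.
Proof. by apply: bsaP; rewrite /= scalerA rmorphM. Qed.
Fact bsa_scale1r : left_id 1 bsa_scale.
Proof. by move=> A; apply: bsaP; rewrite /= scale1r. Qed.
Fact bsa_scalerDr : right_distributive bsa_scale +%R.
Proof. by move=> a A X; apply: bsaP; rewrite /= scalerDr. Qed.
Fact bsa_scalerDl A : {morph bsa_scale^~ A : a b / a + b}.
Proof. by move=> a b; apply: bsaP; rewrite /= rmorphD scalerDl. Qed.

HB.instance Definition _ := GRing.Zmodule_isLmodule.Build R bsa
  bsa_scalerA bsa_scale1r bsa_scalerDr bsa_scalerDl.

Definition bsa_norm A : R := opnorm A.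

Fact bsa_normD A X : bsa_norm (A + X) <= bsa_norm A + bsa_norm X.
Proof. exact: opnormD. Qed.
Fact bsa_normZ (a : R) A : bsa_norm (a *: A) = `|a| * bsa_norm A.
Proof. exact: opnormZ. Qed.
Fact bsa_norm_eq0 A : bsa_norm A = 0 -> A = 0.
Proof. by move/opnorm_eq0 => A0; apply: bsaP. Qed.

HB.instance Definition _ := Lmodule_isNormed.Build R bsa
  bsa_normD bsa_normZ bsa_norm_eq0.

Lemma bsa_normE A : `|A| = opnorm A. Proof. by []. Qed.

(* The quadratic operator U_X of the special Jordan product (AB + BA) / 2. *)
Fact quad_sa X A : adjoint (bsa_op X * A * X) == bsa_op X * A * X.
Proof. by rewrite !adjointM !bsa_adj mulrA. Qed.

Fact quad_bounded X : (fun A => Bsa (quad_sa X A)) \in @bounded_linear R bsa.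
Proof.
rewrite inE; split.
  move=> a A B; apply: bsaP; apply: bopP => x /=.
  by rewrite /= bopD bopZ.
exists (opnorm X * opnorm X) => A; rewrite !bsa_normE /=.
rewrite (le_trans (opnormM _ _)) // mulrAC ler_wpM2r ?opnorm_ge0 //.
exact: opnormM.
Qed.

Definition quad X : 'B(bsa) := Bop (quad_bounded X).

(* U_{X,Y}, the polarization of U_X normalized so that U_{X,X} = U_X. *)
Fact quad2_sa X Y A :
  adjoint (bsa_op X * A * Y + bsa_op Y * A * X) ==
    bsa_op X * A * Y + bsa_op Y * A * X.
Proof. by rewrite adjointD !adjointM !bsa_adj !mulrA addrC. Qed.

Fact quad2_bounded X Y :
  (fun A => 2^-1 *: Bsa (quad2_sa X Y A)) \in @bounded_linear R bsa.
Proof.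
rewrite inE; split.
  move=> a A B; rewrite scalerA mulrC -scalerA -scalerDr; congr (_ *: _).
  apply: bsaP; apply: bopP => x.
  rewrite -[LHS]/(X (a%:C *: A (Y x) + B (Y x)) + Y (a%:C *: A (X x) + B (X x))).
  by rewrite !bopD !bopZ addrACA -scalerDr.
exists (opnorm X * opnorm Y) => A; rewrite normrZ !bsa_normE /=.
rewrite ger0_norm ?invr_ge0 // mulrC ler_pdivrMr //.
rewrite (le_trans (opnormD _ _)) // mulr_natr mulr2n lerD //.
  rewrite (le_trans (opnormM _ _)) // mulrAC ler_wpM2r ?opnorm_ge0 //.
  exact: opnormM.
rewrite (le_trans (opnormM _ _)) // mulrC -mulrA ler_wpM2l ?opnorm_ge0 //.
exact: opnormM.
Qed.

Definition quad2 X Y : 'B(bsa) := Bop (quad2_bounded X Y).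

(* The Lie algebra of the structure group of V. *)
Definition str : set 'B(bsa) :=
  [set D : 'B(bsa) | exists Dbar : 'B(bsa),
     forall X : bsa, 2 *: quad2 X (D X) = D * quad X - quad X * Dbar].

Fact lradj_sa T A :
  adjoint (T * A + bsa_op A * adjoint T) == T * A + bsa_op A * adjoint T.
Proof. by rewrite adjointD !adjointM adjointK !bsa_adj addrC. Qed.

Fact lradj_bounded T : (fun A => Bsa (lradj_sa T A)) \in @bounded_linear R bsa.
Proof.
rewrite inE; split.
  move=> a A B; apply: bsaP; apply: bopP => x.
  rewrite -[LHS]/(T (a%:C *: A x + B x)
    + (a%:C *: A (adjoint T x) + B (adjoint T x))).
  by rewrite bopD bopZ addrACA -scalerDr.
exists (opnorm T + opnorm (adjoint T)) => A; rewrite !bsa_normE /=.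
rewrite (le_trans (opnormD _ _)) // mulrDl lerD ?opnormM //.
by rewrite mulrC opnormM.
Qed.

(* ell_T + r_{T^dagger} *)
Definition lradj T : 'B(bsa) := Bop (lradj_bounded T).

End HilbertTheory.

Arguments str {R} H _.

(* Main.v *)
Require Import Defs.
From mathcomp Require Import all_boot all_order all_algebra.
From mathcomp Require Import complex ring lra.
From mathcomp Require Import all_classical all_reals topology normedtype.

(* Subtracting a suitable [lradj S] reduces to [D 1 = 0], where [D] satisfies the
   triple identity [D(XAX) = D(X)AX + X D(A) X + XA D(X)]. Fix a unit vector [e],
   with projection [P], and put [s0 = D(P)e] and [s X = D(X)e + X s0]. Comparing
   the [(e, e)] entries in the identities for [D(P(XAX)P)] and [D(XAX)] gives
     <D(A)x, x> = -2 Re <A (s X), x>   for x = Xe.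
   Every [x] with [<x, e>] real is of the form [Xe], and [x |-> s X] is then
   induced by a bounded complex-linear operator [T]; hence the quadratic forms of
   [D(A)] and [-(T^dagger A + A T)] agree. *)

Set Implicit Arguments.
Unset Strict Implicit.
Unset Printing Implicit Defensive.

Import Order.TTheory GRing.Theory Num.Theory.
Import numFieldNormedType.Exports.
Local Open Scope classical_set_scope.
Local Open Scope complex_scope.
Local Open Scope ring_scope.

Lemma bopN (K : numFieldType) (U : normedModType K) (T : 'B(U)) x :
  T (- x) = - T x.
Proof. by rewrite -scaleN1r bopZ scaleN1r. Qed.

(** * Real inner product, rank-one operators, and a pointwise form of [str] *)

Section RealInnerProduct.
Variables (R : realType) (H : hilbertType R).
Implicit Types (x y z : H) (T S B : 'B(H)) (A X Y : bsa H).

Local Notation dot := (@hdot R H).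

Definition rdot x y : R := complex.Re (dot x y).

Lemma rdotDl x y z : rdot (x + y) z = rdot x z + rdot y z.
Proof. by rewrite /rdot dotDl raddfD. Qed.

Lemma rdotDr x y z : rdot z (x + y) = rdot z x + rdot z y.
Proof. by rewrite /rdot dotDr raddfD. Qed.

Lemma rdotC x y : rdot x y = rdot y x.
Proof. by rewrite /rdot dotC; case: (dot y x). Qed.

Lemma rdotZl (r : R) x y : rdot (r%:C *: x) y = r * rdot x y.
Proof. by rewrite /rdot dotZl; case: (dot x y) => a b /=; ring. Qed.

Lemma rdot0l x : rdot 0 x = 0.
Proof. by rewrite -(scale0r 0) -(rmorph0 (real_complex R)) rdotZl mul0r. Qed.

Lemma rdotZ (a : R[i]) x y : rdot (a *: x) (a *: y) =
  complex.Re (a * a^*) * rdot x y.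
Proof.
rewrite /rdot dotZl dotZr; case: a => a b; case: (dot x y) => c d /=.
by ring.
Qed.

Lemma rdot_adj T x y : rdot (T x) y = rdot x (adjoint T y).
Proof. by rewrite /rdot adjointP. Qed.

Lemma rdot_sa A x y : rdot (A x) y = rdot x (A y).
Proof. by rewrite rdot_adj bsa_adj. Qed.

Lemma rdot_eq0 x : rdot x x = 0 -> x = 0.
Proof.
rewrite /rdot nrm2 /= => /eqP; rewrite sqrf_eq0 => /eqP; exact: nrm_eq0.
Qed.

(** Polarization: expanding the form at [x + B x] leaves only [2 * rdot (B x) (B x)]. *)
Lemma sa_form_eq0 B : adjoint B = B -> (forall x, rdot (B x) x = 0) -> B = 0.
Proof.
move=> Bsa B0; apply: bopP => x; apply: rdot_eq0.
have := B0 (x + B x); rewrite bopD !(rdotDl, rdotDr) !B0.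
by rewrite [rdot (B (B x)) x]rdot_adj Bsa -/(rdot _ _) => h; lra.
Qed.

Fact rank1_bounded x y : (fun z => dot z y *: x) \in @bounded_linear _ H.
Proof.
rewrite inE; split; first by move=> a u v; rewrite dotDl dotZl scalerDl scalerA.
exists (`|x| * `|y|) => z; rewrite normrZ mulrC -mulrA ler_wpM2l //.
by rewrite mulrC cauchy_schwarz.
Qed.

Definition rank1 x y : 'B(H) := Bop (rank1_bounded x y).

Lemma adjoint_rank1 x y : adjoint (rank1 x y) = rank1 y x.
Proof.
by apply: adjoint_uniq => u v; rewrite /= dotZl dotZr -dotC mulrC.
Qed.

Fact proj1_sa x : adjoint (rank1 x x) == rank1 x x.
Proof. by rewrite adjoint_rank1. Qed.

Definition proj1 x : bsa H := Bsa (proj1_sa x).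

Fact sym2_sa x y : adjoint (rank1 x y + rank1 y x) == rank1 x y + rank1 y x.
Proof. by rewrite adjointD !adjoint_rank1 addrC. Qed.

Definition sym2 x y : bsa H := Bsa (sym2_sa x y).

Lemma sym2E x y z : sym2 x y z = dot z y *: x + dot z x *: y.
Proof. by []. Qed.

Fact bsa1_sa : adjoint (1 : 'B(H)) == 1.
Proof. by apply/eqP/adjoint_uniq. Qed.

Definition bsa1 : bsa H := Bsa bsa1_sa.

Lemma bsa_addE A X x : (A + X) x = A x + X x. Proof. by []. Qed.
Lemma bsa_scaleE (r : R) A x : (r *: A) x = r%:C *: A x. Proof. by []. Qed.

Lemma bsa_eq A X : (forall x, A x = X x) -> A = X.
Proof. by move=> AX; apply/bsaP/bopP. Qed.

Lemma quadE X A x : quad X A x = X (A (X x)). Proof. by []. Qed.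
Lemma lradjE T A x : lradj T A x = T (A x) + A (adjoint T x). Proof. by []. Qed.

Lemma lradjD T S : lradj (T + S) = lradj T + lradj S.
Proof.
apply: bopP => A; apply: bsa_eq => x.
rewrite bop_addE bsa_addE !lradjE adjointD !bop_addE bopD.
by rewrite addrACA.
Qed.

(** The factor 2 cancels the normalization of [quad2], leaving a scalar-free identity between
    vectors. *)
Lemma strE (D : 'B(bsa H)) : str H D <-> exists E : 'B(bsa H), forall X A x,
  D (quad X A) x = X (A (D X x)) + D X (A (X x)) + X (E A (X x)).
Proof.
have L X A x (D' : 'B(bsa H)) : (2 *: quad2 X (D' X)) A x =
    X (A (D' X x)) + D' X (A (X x)).
  rewrite -[RHS]/(Bsa (quad2_sa X (D' X) A) x); congr (bop_fun (bsa_op _) x).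
  rewrite -[LHS]/(2 *: (2^-1 *: Bsa (quad2_sa X (D' X) A))).
  by rewrite scalerA divff ?pnatr_eq0 // scale1r.
have Q (E : 'B(bsa H)) X A x : (D * quad X - quad X * E) A x =
    D (quad X A) x - X (E A (X x)) by [].
split=> -[E DE]; exists E => X.
  move=> A x; move: (congr1 (fun F : 'B(bsa H) => F A x) (DE X)).
  by rewrite L Q => ->; rewrite subrK.
by apply: bopP => A; apply: bsa_eq => x; rewrite L Q DE addrK.
Qed.

Lemma lradj_str T : str H (lradj T).
Proof.
(* The companion [A |-> -(T^dagger A + A T)] cancels the terms [X A T X] and [X T^dagger A X] coming
   from [lradj T X]. *)
apply/strE; exists (lradj (- adjoint T)) => X A x.
rewrite !lradjE !quadE adjointN adjointK !bop_oppE !bopD !bopN.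
move: (T (X (A (X x)))) (X (A (X (adjoint T x)))) (X (A (T (X x)))).
move: (X (adjoint T (A (X x)))) => d a b c.
apply/esym/eqP; rewrite -opprD subr_eq; apply/eqP.
by rewrite addrACA (addrC c) addrACA (addrC c).
Qed.

Lemma dot_sa_real A x : dot (A x) x = (rdot (A x) x)%:C.
Proof.
have := dotC (A x) x; have := adjointP A x x; rewrite bsa_adj => <-.
rewrite /rdot; case: (dot _ _) => a b [] /= bN.
by congr (_ +i* _); lra.
Qed.

End RealInnerProduct.

(** * Operators satisfying the triple identity are inner *)

Section TripleDerivation.
Variables (R : realType) (H : hilbertType R) (D : 'B(bsa H)).
Implicit Types (x y z : H) (A X Y : bsa H).

Local Notation dot := (@hdot R H).

Hypothesis Dtriple : forall X A x,
  D (quad X A) x = X (A (D X x)) + D X (A (X x)) + X (D A (X x)).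

Variable e : H.
Hypothesis e1 : dot e e = 1.

Let P := proj1 e.
Let s0 := D P e.
Let s X := D X e + X s0.

Let Pe : P e = e.
Proof. by rewrite /P /= e1 scale1r. Qed.

(** For [X = A = 1] the triple identity reads [v = v + v + v]. *)
Let D1 x : D (bsa1 H) x = 0.
Proof.
have := Dtriple (bsa1 H) (bsa1 H) x.
have -> : quad (bsa1 H) (bsa1 H) = bsa1 H by apply: bsa_eq.
rewrite /=; set v := D _ x => /eqP.
rewrite -addrA eq_sym -subr_eq0 addrAC subrr add0r -mulr2n -scaler_nat scaler_eq0.
by rewrite pnatr_eq0 => /eqP.
Qed.

(** The triple identity for [P] and [1], evaluated at [e], reads [s0 = P s0 + s0]. *)
Let dot_s0 : dot s0 e = 0.
Proof.
have := Dtriple P (bsa1 H) e.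
have -> : quad P (bsa1 H) = P.
  by apply: bsa_eq => x; rewrite quadE -[X in P X]/(P x) /= dotZl e1 mulr1.
rewrite D1 Pe bop0 addr0 /= -/s0 => /eqP.
rewrite eq_sym -subr_eq0 addrK scaler_eq0 => /orP[/eqP//|/eqP e0].
by rewrite e0 linear0r.
Qed.

(** Since [P A P] is the multiple [<A e, e> P], the [(e, e)] entry of its image under [D] is a
    multiple of [<s0, e> = 0]. *)
Let corner A : rdot (D A e) e + 2 * rdot (A e) s0 = 0.
Proof.
have := congr1 (fun z : H => rdot z e) (Dtriple P A e).
have -> : quad P A = rdot (A e) e *: P.
  apply: bsa_eq => x; rewrite quadE bsa_scaleE /= bopZ dotZl dot_sa_real.
  by rewrite scalerA mulrC.
rewrite bopZ bsa_scaleE rdotZl !rdotDl !Pe !(rdot_sa P) Pe (rdot_sa A).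
rewrite (rdot_sa (D P) (A e)) -/s0 [rdot s0 e]/rdot dot_s0 /= mulr0 => h.
by rewrite (rdot_sa A s0) (rdotC s0) in h; lra.
Qed.

Let form X A : rdot (D A (X e)) (X e) + 2 * rdot (A (s X)) (X e) = 0.
Proof.
have := corner (quad X A); rewrite quadE Dtriple !rdotDl.
rewrite !(rdot_sa X) (rdotC (D X _)) -(rdot_sa (D X)) /s bopD rdotDl.
rewrite (rdot_sa A (D X e)) (rdot_sa A (X s0)) (rdotC (D X e)) (rdotC (X s0)).
by move=> h; lra.
Qed.

Let sD X Y : s (X + Y) = s X + s Y.
Proof. by rewrite /s bopD !bsa_addE addrACA. Qed.

Let sZ (r : R) X : s (r *: X) = r%:C *: s X.
Proof. by rewrite /s bopZ !bsa_scaleE scalerDr. Qed.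

(** Polarization of [rdot (s Z) (Z e) = 0], which is [form] at the identity operator. *)
Let skew X Y : rdot (s X) (Y e) + rdot (s Y) (X e) = 0.
Proof.
have F Z : rdot (s Z) (Z e) = 0.
  by have := form Z (bsa1 H); rewrite D1 rdot0l /= => h; lra.
have := F X; have := F Y; have := F (X + Y).
by rewrite sD bsa_addE !(rdotDl, rdotDr) => *; lra.
Qed.

(** For [y] orthogonal to [e], [sym2 y e] is a self-adjoint operator sending [e] to [y]. It is only
    real-linear in [y], so complex linearity of [t] needs a separate argument. *)
Let t y := s (sym2 y e).

Let tD y z : t (y + z) = t y + t z.
Proof.
rewrite /t -sD; congr s; apply: bsa_eq => x.
by rewrite bsa_addE !sym2E scalerDr dotDr scalerDl addrACA.
Qed.

Let tZr (r : R) y : t (r%:C *: y) = r%:C *: t y.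
Proof.
rewrite /t -sZ; congr s; apply: bsa_eq => x.
rewrite bsa_scaleE !sym2E scalerDr !scalerA dotZr mulrC.
by rewrite (conjc_real r : (r%:C)^* = r%:C).
Qed.

Let t0 : t 0 = 0.
Proof. by have := tZr 0 0; rewrite scaler0 => ->; rewrite scale0r. Qed.

Let sym2_e y : dot y e = 0 -> sym2 y e e = y.
Proof.
by move=> ye; rewrite sym2E e1 scale1r dotC ye conjC0 scale0r addr0.
Qed.

Let ti y : dot y e = 0 -> t ('i%C *: y) = 'i%C *: t y.
Proof.
move=> ye; have iye : dot ('i%C *: y) e = 0 by rewrite dotZl ye mulr0.
(* [form] makes [Re <A w, y>] vanish for all [A], and the choice
   [A = sym2 y w] turns this into [|w|^2 |y|^2 = 0]. *)
pose w := t y + 'i%C *: t ('i%C *: y).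
suff w0 : w = 0.
  apply/eqP; rewrite -subr_eq0; apply/eqP.
  rewrite -[LHS](scale1r) -[1]opprK -(sqr_i R) expr2 scaleNr -scalerA.
  by rewrite scalerBr scalerA -expr2 sqr_i scaleN1r opprK addrC -/w w0 scaler0 oppr0.
(* The form of [D A] takes the same value at [y] and at [i y]; comparing [form] for the two gives
   [Re <A w, y> = 0]. *)
have Aw A : rdot (A w) y = 0.
  have := form (sym2 y e) A; have := form (sym2 ('i%C *: y) e) A.
  rewrite !sym2_e // -/(t _) -/(t _) !bopZ rdotZ /w bopD rdotDl bopZ.
  rewrite /rdot !(dotZl, dotZr).
  case: (dot (A (t y)) y) (dot (A (t ('i%C *: y))) y) => a b [c d] /=.
  by move=> *; lra.
(* The real part vanishes by [Aw] at the identity, the imaginary part by [skew] for [y] and [i y].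
   Hence [sym2 y w] sends [w] to [|w|^2 y] with no second term. *)
have wy : dot w y = 0.
  have := skew (sym2 y e) (sym2 ('i%C *: y) e).
  rewrite !sym2_e // -/(t _) -/(t _).
  have := Aw (bsa1 H); rewrite [bsa1 H _]/= /w.
  move: (t y) (t ('i%C *: y)) => u v; rewrite /rdot !(dotDl, dotZl, dotZr).
  case: (dot u y) (dot v y) => a b [c d] /= h1 h2.
  by apply/eqP; rewrite eq_complex /=; apply/andP; split; apply/eqP; lra.
have := Aw (sym2 y w); rewrite sym2E wy scale0r addr0 nrm2 rdotZl /rdot nrm2 /=.
move/eqP; rewrite mulf_eq0 !sqrf_eq0 => /orP[/eqP/nrm_eq0//|/eqP/nrm_eq0 y0].
by rewrite /w y0 scaler0 t0 scaler0 addr0.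
Qed.

Let tZ (a : R[i]) y : dot y e = 0 -> t (a *: y) = a *: t y.
Proof.
move=> ye; have aE := complexE a; rewrite aE !scalerDl tD tZr.
congr (_ + _); rewrite mulrC -!scalerA tZr.
by rewrite ti.
Qed.

Let r x := x - dot x e *: e.

Let r_perp x : dot (r x) e = 0.
Proof. by rewrite dotBl dotZl e1 mulr1 subrr. Qed.

Let nrm_e : nrm e = 1.
Proof.
apply/eqP; rewrite -(@pexpr_eq1 _ _ 2) ?nrm_ge0 //; apply/eqP.
by apply: (@complexI R); rewrite -nrm2 e1.
Qed.

Let cs x y : complex.Re `|dot x y| <= nrm x * nrm y.
Proof.
by rewrite -lecR -ge0_ReC ?normr_ge0 // rmorphM /= -!nrmE cauchy_schwarz.
Qed.

Let nrm_r x : nrm (r x) <= 2 * nrm x.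
Proof.
rewrite (le_trans (nrmD _ _)) // nrmN nrmZ nrm_e mulr1.
by have := cs x e; rewrite nrm_e mulr1 => h; lra.
Qed.

Let opnorm_sym2 y : opnorm (sym2 y e) <= 2 * nrm y.
Proof.
apply: opnorm_le => [x|]; last by rewrite mulr_ge0 ?nrm_ge0.
rewrite sym2E (le_trans (nrmD _ _)) // !nrmZ nrm_e mulr1.
have := cs x e; rewrite nrm_e mulr1 => /(ler_wpM2r (nrm_ge0 y)).
by have := cs x y => h1 h2; lra.
Qed.

Let t_bounded : exists2 M : R, 0 <= M & forall y, nrm (t y) <= M * nrm y.
Proof.
have [M M0 DM] := bounded_linear_gt0 (bop_bl D).
(* The two summands of [s] are bounded by [M] and [nrm s0] times the norm of [sym2 y e], which is at
   most [2 * nrm y]. *)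
exists (2 * (M + nrm s0)) => [|y].
  by rewrite mulr_ge0 // addr_ge0 ?nrm_ge0 // ltW.
rewrite (le_trans (nrmD _ _)) //.
have := opnorm_ub (D (sym2 y e)) e; rewrite nrm_e mulr1 => h1.
have := opnorm_ub (sym2 y e) s0 => h2.
have := DM (sym2 y e); rewrite !bsa_normE => h3.
have h4 := ler_wpM2l (ltW M0) (opnorm_sym2 y).
have h5 := ler_wpM2l (nrm_ge0 s0) (opnorm_sym2 y).
by lra.
Qed.

(** The complex-linear extension of [t] from the orthogonal complement of [e], with [e] sent to
    [s P = s0]. *)
Let f x := dot x e *: s0 + t (r x).

Fact f_bounded : f \in @bounded_linear _ H.
Proof.
rewrite inE; split.
  move=> a x y; rewrite /f.
  have -> : r (a *: x + y) = a *: r x + r y.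
    by rewrite /r dotDl dotZl scalerDl -scalerA opprD addrACA -scalerBr.
  rewrite tD tZ //; move: (t (r x)) (t (r y)) s0 => u v w.
  by rewrite dotDl dotZl scalerDl -scalerA addrACA -scalerDr.
have [M M0 tM] := t_bounded.
exists (nrm s0 + 2 * M)%:C => x.
rewrite !nrmE -rmorphM /= lecR (le_trans (nrmD _ _)) // nrmZ.
have h1 := tM (r x); have h2 := ler_wpM2l M0 (nrm_r x).
have := cs x e; rewrite nrm_e mulr1 => /(ler_wpM2r (nrm_ge0 s0)) h3.
by lra.
Qed.

Let T : 'B(H) := Bop f_bounded.

Lemma triple_derivation_inner : exists S, D = lradj S.
Proof.
exists (- adjoint T).
apply: bopP => A; apply: bsaP.
pose B : 'B(H) := bsa_op (D A) + (adjoint T * A + bsa_op A * T).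
suff B0 : B = 0.
  apply: bopP => x; rewrite lradjE adjointN adjointK !bop_oppE.
  have : B x = 0 by rewrite B0.
  rewrite /B !bop_addE !bop_mulE => /eqP; rewrite addr_eq0 => /eqP ->.
  by rewrite opprD bopN.
apply: sa_form_eq0 => [|x].
  by rewrite /B !adjointD !adjointM adjointK !bsa_adj [X in _ + X]addrC.
(* The operator [X = q P + sym2 (r y) e] is self-adjoint because [q] is real, and it satisfies
   [X e = y] and [s X = f y]. *)
have real (q : R) y : dot y e = q%:C -> rdot (B y) y = 0.
  move=> yq; have := form (q *: P + sym2 (r y) e) A.
  rewrite sD sZ bsa_addE bsa_scaleE Pe sym2_e // -/(t _).
  have -> : s P = s0 by rewrite /s /P /= dot_s0 scale0r addr0.
  rewrite -yq -/(f y) [_ + r y]addrC subrK => h.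
  rewrite /B !bop_addE !bop_mulE !rdotDl [rdot (adjoint T _) _]rdot_adj adjointK.
  by rewrite -[T y]/(f y) (rdotC (A y)) -(rdot_sa A (f y)); lra.
(* Replacing [x] by [a x] multiplies the form of [B] by [|a|^2], so [<x, e>] may
   be made real. *)
have [c0|c0] := eqVneq (dot x e) 0; first exact: (real 0).
have cc : 0 < dot x e * (dot x e)^* by rewrite mul_conjC_gt0.
have := real (complex.Re (dot x e * (dot x e)^* )) ((dot x e)^* *: x).
rewrite dotZl bopZ rdotZ conjCK [_^* * _]mulrC -ge0_ReC ?ltW // => /(_ erefl).
move/eqP; rewrite mulf_eq0 => /orP[/eqP c|/eqP//].
by have := cc; rewrite (ge0_ReC (ltW cc)) c ltxx.
Qed.

End TripleDerivation.

(** * Reduction to operators that vanish at the identity *)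

Lemma strB (R : realType) (H : hilbertType R) (D D' : 'B(bsa H)) :
  str H D -> str H D' -> str H (D - D').
Proof.
have sub (F F' : 'B(bsa H)) A x : (F - F') A x = F A x - F' A x.
  by rewrite bop_addE bsa_addE bop_oppE.
move=> /strE[E DE] /strE[E' DE']; apply/strE; exists (E - E') => X A x.
rewrite !sub DE DE' !bopD !bopN !opprD [LHS]addrACA; congr (_ + _).
exact: addrACA.
Qed.

(** Putting [X = 1] in the defining identity forces the companion [E] to equal [D]. *)
Lemma str_unital_triple (R : realType) (H : hilbertType R) (D : 'B(bsa H)) :
    str H D -> (forall x, D (bsa1 H) x = 0) -> forall X A x,
  D (quad X A) x = X (A (D X x)) + D X (A (X x)) + X (D A (X x)).
Proof.
move=> /strE[E DE] D1.
suff ED A x : E A x = D A x by move=> X A x; rewrite DE ED.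
have := DE (bsa1 H) A x; rewrite !D1 bop0 !add0r.
by have -> : quad (bsa1 H) A = A by exact: bsa_eq.
Qed.

Lemma exists_unit_vector (R : realType) (H : hilbertType R) :
  infinite_dimensional H -> exists e : H, hdot H e e = 1.
Proof.
move=> Hinf; have [[x x0]|H0] := pselect (exists x : H, x != 0); last first.
  (* The zero space is spanned by the empty family. *)
  case: Hinf; exists 0, (fun=> 0) => x; exists (fun=> 0).
  by rewrite big_ord0; apply: contrapT => /eqP ?; apply: H0; exists x.
have nx0 : nrm x != 0 by apply: contra x0 => /eqP/nrm_eq0->.
exists (((nrm x)^-1)%:C *: x); rewrite dotZl dotZr nrm2.
rewrite (conjc_real _ : (_%:C)^* = _%:C) -!rmorphM /=.
by rewrite (_ : _ * _ = 1) //; field.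
Qed.

Theorem corollary4p12 (R : realType) (H : hilbertType R)
    (H_infinite : infinite_dimensional H) (H_separable : separable H) :
  str H = [set lradj T | T in [set: 'B(H)]].
Proof.
have [e e1] := exists_unit_vector H_infinite.
apply/seteqP; split=> [D strD|_ [T _ <-]]; last exact: lradj_str.
(* As [D 1] is self-adjoint, its half [S] satisfies [S + S^dagger = D 1], so [lradj S] agrees with
   [D] at the identity. *)
pose S : 'B(H) := (2^-1)%:C *: bsa_op (D (bsa1 H)).
have SE x : (D - lradj S) (bsa1 H) x = 0.
  rewrite bop_addE bsa_addE bop_oppE [X in _ + X]/(- lradj S (bsa1 H) x) lradjE.
  rewrite /S adjointZ bsa_adj (conjc_real _ : (_%:C)^* = _%:C).
  rewrite !bop_scaleE -scalerDl -rmorphD /=.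
  by rewrite (_ : 2^-1 + 2^-1 = 1) ?scale1r ?subrr //; lra.
have tD := str_unital_triple (strB strD (lradj_str S)) SE.
have [T DT] := triple_derivation_inner tD e1.
by exists (T + S) => //; rewrite lradjD -DT subrK.
Qed.
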